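(* Let $d\ge 3$ and let $f$ be any increasing unbounded real-valued function on $[0,\infty)$. Then there is a collection of non-overlapping (pairwise disjoint) closed balls $\overline{B}(c_n,r_n)$, $n\ge 1$, in $\mathbb{R}^d$ with radii $r_n>0$, such that $\mathbb{R}^d\setminus\bigcup_{n\ge1}\overline{B}(c_n,r_n)$ is a region containing $0$, which is separated and avoidable, and for which $$r_n^{d-2}|c_n|^2\le f(|c_n|)\ \text{ for all } n\ge 1\qquad\text{and}\qquad \sum_{n=1}^\infty\left(\frac{r_n}{|c_n|}\right)^{d-2}=\infty.$$
   Context: $\overline{B}(c,r)$ denotes the closed ball in $\mathbb{R}^d$ with centre $c$ and radius $r$. A region is a connected open set. The collection of balls is called separated if there is a positive number $\epsilon$ such that $|c_n-c_m|\ge 2\epsilon$ for all $n\neq m$. It is called avoidable if there is a positive probability that Brownian motion in $\mathbb{R}^d$ started from $0$ never hits any of the balls. *)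

(* Defs.v *)
From HB Require Import structures.
From mathcomp Require Import all_boot all_order all_algebra.
From mathcomp Require Import all_classical all_reals all_analysis.

Set Implicit Arguments.
Unset Strict Implicit.
Unset Printing Implicit Defensive.

Import Order.TTheory GRing.Theory Num.Theory.
Import numFieldNormedType.Exports.

Local Open Scope classical_set_scope.
Local Open Scope ring_scope.

(* The norm `|x| that the library puts on 'rV[R]_d is the sup norm, hence a
   separate Euclidean norm; both induce the library's topology on 'rV[R]_d. *)
Definition enorm (R : realType) (d : nat) (x : 'rV[R]_d) : R :=
  Num.sqrt (\sum_(i < d) x ord0 i ^+ 2).

Definition cball (R : realType) (d : nat) (c : 'rV[R]_d) (r : R) :
  set 'rV[R]_d := closed_ball_ (@enorm R d) c r.

Definition region (R : realType) (d : nat) (A : set 'rV[R]_d) : Prop :=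
  open A /\ connected A.

Definition separated_centres (R : realType) (d : nat) (c : nat -> 'rV[R]_d) :
  Prop :=
  exists2 eps : R, 0 < eps &
    forall n m : nat, n <> m -> 2 * eps <= enorm (c n - c m).

(* 'rV[R]_d with its Borel sigma-algebra *)
Definition borelRV (R : realType) (d : nat) :=
  g_sigma_algebraType (@open 'rV[R]_d).

(* The product rule is only required of the whole family: taking some of the
   B k to be setT gives it for the subfamilies. *)
Definition mutually_independent (R : realType) (dT dU : measure_display)
    (T : measurableType dT) (U : measurableType dU) (P : probability T R)
    (n : nat) (X : 'I_n -> T -> U) : Prop :=
  forall B : 'I_n -> set U, (forall k, measurable (B k)) ->
    P (\bigcap_(k in [set: 'I_n]) (X k @^-1` B k)) =
    (\prod_(k < n) P (X k @^-1` B k))%E.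

(* Brownian motion in R^d started from x. Only the values W t for t >= 0 are
   constrained. In bm_gaussian, the increment over [s, t] has law
   N(0, (t - s) I_d), that is, its coordinates are independent and normal
   (the second parameter of normal_prob is the standard deviation).
   Every path is continuous, which makes events such as "W never hits a given
   closed set" measurable. *)
Record brownian_motion (R : realType) (d : nat) (dT : measure_display)
    (T : measurableType dT) (P : probability T R) (x : 'rV[R]_d)
    (W : R -> T -> 'rV[R]_d) : Prop := BrownianMotion {
  bm_measurable : forall t : R, 0 <= t ->
    measurable_fun [set: T] (W t : T -> borelRV R d) ;
  bm_start : forall w : T, W 0 w = x ;
  bm_independent : forall (n : nat) (t : nat -> R),
    0 <= t 0%N -> (forall k : nat, t k <= t k.+1) ->
    mutually_independent P
      (fun (k : 'I_n) (w : T) => (W (t k.+1) w - W (t k) w : borelRV R d)) ;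
  bm_gaussian : forall s t : R, 0 <= s -> s < t ->
    forall A : 'I_d -> set R, (forall i, measurable (A i)) ->
    P [set w | forall i : 'I_d, A i ((W t w - W s w) ord0 i)] =
    (\prod_(i < d) normal_prob 0 (Num.sqrt (t - s)) (A i))%E ;
  bm_continuous : forall w : T,
    {within [set t : R | 0 <= t], continuous (fun t : R => W t w)}
}.

Definition never_hits (R : realType) (d : nat) (T : Type)
    (c : nat -> 'rV[R]_d) (r : nat -> R) (W : R -> T -> 'rV[R]_d) : set T :=
  [set w | forall t : R, 0 <= t -> forall n : nat,
           ~ cball (c n) (r n) (W t w)].

(* All Brownian motions started from 0 have the same law on path space, so the
   probability below does not depend on the chosen one. *)
Definition avoidable (R : realType) (d : nat)
    (c : nat -> 'rV[R]_d) (r : nat -> R) : Prop :=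
  forall (dT : measure_display) (T : measurableType dT) (P : probability T R)
    (W : R -> T -> 'rV[R]_d),
  brownian_motion P 0 W -> (0 < P (never_hits c r W))%E.

(* Main.v *)
Require Import Defs.
From HB Require Import structures.
From mathcomp Require Import all_boot all_order all_algebra.
From mathcomp Require Import all_classical all_reals all_analysis.
From mathcomp Require Import measurable_realfun ring lra.

Set Implicit Arguments.
Unset Strict Implicit.
Unset Printing Implicit Defensive.

Import Order.TTheory GRing.Theory Num.Theory.
Import numFieldNormedType.Exports.

Local Open Scope classical_set_scope.
Local Open Scope ring_scope.

(** The balls come in clusters of which Brownian motion avoids all at once,
while the series counts every ball of a cluster separately.

Cluster [k] is a cubic block of [m_k ^ d] integer points next to the point
[N_k e_1], with [m_k + 1 <= dl_k * N_k]. To hit one of its balls the motion must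
enter a cube of half-side [dl_k * N_k] at distance [N_k] from its start. By
Brownian scaling the probability of that is bounded in terms of [dl_k] alone, and
the bound tends to [0] with [dl_k] because [d >= 3] ([bm_ball_avoidable]); so the
[dl_k] can be chosen with these probabilities summing to at most [1/2], whatever
the [N_k].
The radii are given by [r ^ (d - 2) * |c| ^ 2 = g |c|], where [g <= f] is
nondecreasing, unbounded, and at most [(1/4) ^ (d - 2) * |c| ^ 2], which makes
the radii at most [1/4]. A ball then contributes [g |c| / |c| ^ d] to the series
and the whole cluster about [dl_k ^ d * g N_k], up to a factor depending on [d].
As [g] is unbounded, [N_k], chosen after [dl_k], can make this at least [k + 1]
([cluster_parameters]): the series diverges.

The estimate [bm_ball_avoidable] uses the Gaussian law of single increments and
the continuity of paths, but neither the Markov property nor any independence.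
Time is cut into short intervals. If the motion meets the cube during one of
them, then either it is near the cube at the left end, which the bound on the
Gaussian density controls ([bm_near_le]), or it oscillates a lot during the
interval, which dyadic chaining and Gaussian tails control ([bm_oscillation]).
The interval lengths are tuned so that both families of bounds are summable;
for the first one this needs the third power that dimension [3] provides.

The topological part rests on the centres being distinct integer points and
the radii at most [1/4]: everything can be compared with the grid of unit cells
centred at integer points, whose walls stay away from the balls. The sup norm
is used wherever possible, since it is below the Euclidean one and since
products of intervals are what the Gaussian law is stated for. *)

(** * Gaussian interval and tail bounds *)

Section gaussian.
Variable R : realType.
Implicit Types (a m s x : R) (p : nat).

(** The density is at most [1 / (s * sqrt (2 * pi))], and [2 <= sqrt (2 * pi)]. *)
Lemma normal_prob_itv_le m s a x : 0 < s -> 0 <= a ->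
  (normal_prob m s `[(x - a)%R, (x + a)%R] <= (a / s)%:E)%E.
Proof.
move=> s0 a0; have sn0 : s != 0 by rewrite gt_eqF.
have mI : measurable (`[(x - a)%R, (x + a)%R] : set R) by exact: measurable_itv.
apply: (@le_trans _ _ (\int[lebesgue_measure]_(y in `[(x - a)%R, (x + a)%R])
    (normal_peak s)%:E)%E).
  apply: ge0_le_integral => //=.
  - by move=> y _; rewrite lee_fin normal_pdf_ge0.
  - apply/measurable_EFinP; apply: measurable_funTS.
    exact: measurable_normal_pdf.
  - by move=> y _; rewrite lee_fin normal_pdf_ub.
rewrite integral_cst//= lebesgue_measure_itv/= lte_fin.
case: ifPn => [_|_]; last by rewrite mule0 lee_fin divr_ge0// ltW.
rewrite -EFinD -EFinM lee_fin.
have -> : x + a - (x - a) = 2 * a by ring.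
have q0 : 0 < s ^+ 2 * pi *+ 2.
  by rewrite pmulrn_lgt0// mulr_gt0 ?pi_gt0 ?exprn_gt0.
rewrite mulrA mulrC ler_wpM2l// mulrC /normal_peak ler_pdivrMr ?sqrtr_gt0//.
rewrite mulrC ler_pdivlMr//.
rewrite -[X in _ * X](ger0_norm (ltW s0)) -sqrtr_sqr.
have -> : (2 : R) = Num.sqrt 4.
  by rewrite (_ : 4 = 2 ^+ 2) ?sqrtr_sqr ?ger0_norm//; ring.
rewrite -sqrtrM// ler_sqrt ?(ltW q0)//.
have : s ^+ 2 * 2 <= s ^+ 2 * pi by rewrite ler_wpM2l ?sqr_ge0 ?pi_ge2.
rewrite mulr2n; lra.
Qed.

Lemma expRN_le_pow p x : 0 < x -> expR (- x) <= p.+1`!%:R / x ^+ p.+1.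
Proof.
move=> x0; rewrite expRN -[leRHS]invrK lef_pV2 ?posrE ?expR_gt0//; last first.
  by rewrite invr_gt0 divr_gt0 ?exprn_gt0// ltr0n fact_gt0.
rewrite invf_div; apply: le_trans (expR_ge1Dxn p (ltW x0)).
by rewrite lerDr.
Qed.

Definition tail_cst p : R := 2 * p`!%:R * 4 ^+ p.

Lemma tail_cst_ge0 p : 0 <= tail_cst p.
Proof. by rewrite !mulr_ge0. Qed.

(** Outside [[-x, x]] the density with deviation [s] is at most
[2 * exp (- x ^ 2 / (4 * s ^ 2))] times the density with deviation [2 * s], whose
integral is at most [1]. The exponential is traded for an inverse power, which
is all that the union bounds below need. *)
Lemma normal_prob_tail p s x : 0 < s -> 0 < x ->
  (normal_prob 0 s [set u | (x < `|u|)%R] <=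
     (tail_cst p.+1 * (s ^+ 2 / x ^+ 2) ^+ p.+1)%:E)%E.
Proof.
move=> s0 x0; have s20 : 0 < 2 * s by rewrite mulr_gt0.
set A := [set u : R | _].
have mA : measurable A.
  rewrite (_ : A = ~` `[- x, x]); first by apply: measurableC; exact: measurable_itv.
  by apply/seteqP; split=> u /=; rewrite /A/= in_itv/= -ler_norml ltNge => /negP.
pose c := 2 * expR (- (x ^+ 2 / (4 * s ^+ 2))).
have c0 : 0 <= c by rewrite mulr_ge0// expR_ge0.
apply: (@le_trans _ _ (\int[lebesgue_measure]_(u in A)
    (c%:E * (normal_pdf 0 (2 * s) u)%:E))%E).
  apply: ge0_le_integral => //=.
  - by move=> y _; rewrite lee_fin normal_pdf_ge0.
  - apply/measurable_EFinP; apply: measurable_funTS.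
    exact: measurable_normal_pdf.
  - apply/measurable_EFinP; apply: measurable_funM => //.
    by apply: measurable_funTS; exact: measurable_normal_pdf.
  - move=> u; rewrite /A/= => xu; rewrite -EFinM lee_fin !normal_pdfE ?gt_eqF//.
    have -> : normal_peak s = 2 * normal_peak (2 * s).
      rewrite /normal_peak.
      have -> : (2 * s) ^+ 2 * pi *+ 2 = 2 ^+ 2 * (s ^+ 2 * pi *+ 2) by ring.
      rewrite sqrtrM ?sqr_ge0// sqrtr_sqr ger0_norm//.
      by rewrite invfM mulrA divff ?mul1r// gt_eqF.
    rewrite /c [leRHS]mulrACA ler_wpM2l ?mulr_ge0 ?normal_peak_ge0//.
    rewrite /normal_fun !subr0 -expRD ler_expR.
    have xu2 : x ^+ 2 <= u ^+ 2.
      by rewrite -(real_normK (num_real u)) lerXn2r// ?nnegrE// ltW.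
    have ss0 : 0 < s ^+ 2 by rewrite exprn_gt0.
    rewrite !mulNr -opprD lerN2 exprMn.
    have -> : x ^+ 2 / (4 * s ^+ 2) + u ^+ 2 / ((2 ^+ 2 * s ^+ 2) *+ 2) =
      (x ^+ 2 / 4 + u ^+ 2 / 8) / s ^+ 2 by field; rewrite gt_eqF.
    have -> : u ^+ 2 / (s ^+ 2 *+ 2) = (u ^+ 2 / 2) / s ^+ 2.
      by field; rewrite gt_eqF.
    rewrite ler_pM2r ?invr_gt0//; have := sqr_ge0 u; lra.
rewrite ge0_integralZl_EFin//=; first last.
- apply/measurable_EFinP; apply: measurable_funTS.
  exact: measurable_normal_pdf.
- by move=> y _; rewrite lee_fin normal_pdf_ge0.
apply: (@le_trans _ _ (c%:E * 1)%E).
  by apply: lee_wpmul2l => //; apply: (@probability_le1 _ _ _ (normal_prob 0 (2 * s))).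
rewrite mule1 lee_fin /c /tail_cst -[leRHS]mulrA -[leRHS]mulrA ler_pM2l//.
have x2 : 0 < x ^+ 2 by rewrite exprn_gt0.
have s2 : 0 < s ^+ 2 by rewrite exprn_gt0.
apply: le_trans (expRN_le_pow p _) _; first by rewrite divr_gt0// mulr_gt0.
by rewrite ler_pM2l ?ltr0n ?fact_gt0// -exprVn invf_div -exprMn [in leRHS]mulrA.
Qed.

End gaussian.
Arguments tail_cst : clear implicits.

(** * Union bounds and marginals of Brownian motion *)

Section union_bounds.
Context (R : realType) (dT : measure_display) (T : measurableType dT).
Variable P : probability T R.

Lemma measurable_bigcup_ord n (F : 'I_n -> set T) :
  (forall i, measurable (F i)) -> measurable (\bigcup_i F i).
Proof. by move=> mF; exact: fin_bigcup_measurable. Qed.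

Lemma probability_bigcup_ord_le n (F : 'I_n -> set T) (b : R) :
  (forall i, measurable (F i)) -> (forall i, (P (F i) <= b%:E)%E) ->
  (P (\bigcup_i F i) <= (n%:R * b)%:E)%E.
Proof.
elim: n F => [|n IHn] F mF Fb.
  rewrite mul0r (_ : \bigcup_i F i = set0) ?measure0//.
  by apply/seteqP; split=> w // -[[]].
have -> : \bigcup_i F i =
    (\bigcup_i F (widen_ord (leqnSn n) i)) `|` F ord_max.
  apply/seteqP; split=> w.
    move=> [i _ Fiw]; have [lt_i|] := ltnP i n.
      by left; exists (Ordinal lt_i) => //; congr (F _ w): Fiw; exact: val_inj.
    move=> le_n; right; congr (F _ w): Fiw; apply: val_inj => /=.
    by apply/eqP; rewrite eqn_leq le_n -ltnS ltn_ord.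
  by move=> [[i _ Fiw]|Fw]; [exists (widen_ord (leqnSn n) i)|exists ord_max].
apply: le_trans (measureU2 _ _ _) _ => //.
  exact: measurable_bigcup_ord.
rewrite -natr1 mulrDl mul1r EFinD leeD//.
  by apply: IHn.
exact: Fb.
Qed.

(** The form in which all infinite union bounds are summed. *)
Lemma probability_bigcup_geometric_le (F : nat -> set T) (b : R) : 0 <= b ->
  (forall n, measurable (F n)) ->
  (forall n, (P (F n) <= (b / (2 ^ n.+1)%:R)%:E)%E) ->
  (P (\bigcup_n F n) <= b%:E)%E.
Proof.
move=> b0 mF Fb.
apply: le_trans (measure_sigma_subadditive P mF _ _) _ => //.
  exact: bigcupT_measurable.
apply: le_trans (epsilon_trick0 xpredT b0).
by apply: lee_nneseries => // n _; exact: Fb.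
Qed.

End union_bounds.

Section row_norm.
Variables (R : realType) (d : nat).

Lemma row_norm_leP (v : 'rV[R]_d) (a : R) : 0 <= a ->
  `|v| <= a <-> forall i, `|v ord0 i| <= a.
Proof.
move=> a0; rewrite /Num.norm/= mx_normrE; split=> [/bigmax_leP[_ va] i|va].
  exact: (va (ord0, i)).
by apply/bigmax_leP; split=> // -[i j] _; rewrite (ord1 i); exact: va.
Qed.

Lemma coord_le_norm (v : 'rV[R]_d) i : `|v ord0 i| <= `|v|.
Proof. by have [+ _] := row_norm_leP v (normr_ge0 v); apply. Qed.

Lemma measurable_row_norm_le (dT : measure_display) (T : measurableType dT)
    (X : T -> 'rV[R]_d) (a : R) : 0 <= a ->
  (forall i, measurable_fun [set: T] (fun w => X w ord0 i)) ->
  measurable [set w | `|X w| <= a].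
Proof.
move=> a0 mX.
have -> : [set w | `|X w| <= a] =
    ~` \bigcup_i ~` ((fun w => X w ord0 i) @^-1` `[- a, a]).
  rewrite setC_bigcup; apply/seteqP; split=> w /=.
    by move=> /(row_norm_leP _ a0) Xa i _; apply; rewrite /= in_itv/= -ler_norml.
  move=> Xa; apply/(row_norm_leP _ a0) => i.
  by have /contrapT := Xa i I; rewrite /= in_itv/= -ler_norml.
apply: measurableC; apply: measurable_bigcup_ord => i; apply: measurableC.
by rewrite -[X in measurable X]setTI; apply: mX => //; exact: measurable_itv.
Qed.

End row_norm.

Section brownian_marginals.
Context (R : realType) (d : nat) (dT : measure_display) (T : measurableType dT).
Context (P : probability T R) (x0 : 'rV[R]_d) (W : R -> T -> 'rV[R]_d).
Hypothesis bm : brownian_motion P x0 W.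
Implicit Types (s t a x : R) (C : 'rV[R]_d).

Lemma bm_coord_measurable t i : 0 <= t ->
  measurable_fun [set: T] (fun w => W t w ord0 i).
Proof.
move=> t0; apply: (measurability _ (RGenOpens.measurableE R)) => _ [_ [a [b ->]] <-].
have /(_ measurableT) mW := bm_measurable bm t0.
pose coord_i := fun v : 'rV[R]_d => v ord0 i.
apply: (mW (coord_i @^-1` `]a, b[)); apply: sub_sigma_algebra.
apply: open_comp; last exact: interval_open.
by move=> v _; exact: coord_continuous.
Qed.

Lemma bm_near_measurable t C a : 0 <= t -> 0 <= a ->
  measurable [set w | `|W t w - C| <= a].
Proof.
move=> t0 a0; apply: measurable_row_norm_le => // i.
rewrite (_ : (fun w => _) = (fun w => W t w ord0 i) \- cst (C ord0 i)); last first.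
  by apply/funext => w /=; rewrite !mxE.
by apply: measurable_funB => //; exact: bm_coord_measurable.
Qed.

Lemma bm_far_measurable s t x : 0 <= s -> 0 <= t -> 0 <= x ->
  measurable [set w | x < `|W t w - W s w|].
Proof.
move=> s0 t0 x_ge0.
rewrite (_ : [set w | _] = ~` [set w | `|W t w - W s w| <= x]); last first.
  by apply/seteqP; split=> w /=; rewrite ltNge => /negP.
apply: measurableC; apply: measurable_row_norm_le => // i.
rewrite (_ : (fun w => _) =
    (fun w => W t w ord0 i) \- (fun w => W s w ord0 i)); last first.
  by apply/funext => w /=; rewrite !mxE.
by apply: measurable_funB => //; exact: bm_coord_measurable.
Qed.

(** One coordinate of the increment must exceed [x]. *)
Lemma bm_far_le p s t x : 0 <= s -> s < t -> 0 < x ->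
  (P [set w | (x < `|W t w - W s w|)%R] <=
     (d%:R * (tail_cst R p.+1 * ((t - s) / x ^+ 2) ^+ p.+1))%:E)%E.
Proof.
move=> s0 st x_gt0.
have ts0 : 0 < t - s by rewrite subr_gt0.
pose A (i j : 'I_d) := if j == i then [set u : R | x < `|u|] else [set: R].
pose F (i : 'I_d) := [set w | x < `|(W t w - W s w) ord0 i|].
have mF i : measurable (F i).
  rewrite /F (_ : [set w | _] =
      ((fun w => W t w ord0 i) \- (fun w => W s w ord0 i)) @^-1` ~` `[- x, x]).
    rewrite -[X in measurable X]setTI.
    have : measurable_fun [set: T] ((fun w => W t w ord0 i) \- (fun w => W s w ord0 i)).
      apply: measurable_funB; apply: bm_coord_measurable => //.
      by rewrite (le_trans s0)// ltW.
    apply => //; apply: measurableC; exact: measurable_itv.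
  by apply/seteqP; split=> w /=; rewrite !mxE in_itv/= -ler_norml ltNge => /negP.
have -> : [set w | x < `|W t w - W s w|] = \bigcup_i F i.
  apply/seteqP; split=> w /=; rewrite ltNge.
    move=> /negP xW; apply: contrapT => nF; apply: xW.
    apply/(row_norm_leP _ (ltW x_gt0)) => i; rewrite leNgt; apply/negP => xi.
    by apply: nF; exists i.
  move=> [i _]; rewrite /F/= ltNge => /negP xi; apply/negP.
  by move=> /(row_norm_leP _ (ltW x_gt0)) /(_ i).
apply: probability_bigcup_ord_le => // i.
have -> : F i = [set w | forall j, A i j ((W t w - W s w) ord0 j)].
  apply/seteqP; split=> w /=; rewrite /F/= => H.
    by move=> j; rewrite /A; case: eqP => [->|].
  by have := H i; rewrite /A eqxx.
rewrite (bm_gaussian bm s0 st); last first.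
  move=> j; rewrite /A; case: ifP => // _.
  rewrite (_ : [set u | _] = ~` `[- x, x]).
    by apply: measurableC; exact: measurable_itv.
  by apply/seteqP; split=> u /=; rewrite in_itv/= -ler_norml ltNge => /negP.
rewrite (bigD1 i)//= big1 => [|j /negPf ji]; last first.
  by rewrite /A ji; exact: (@probability_setT _ _ _ (normal_prob 0 _)).
rewrite mule1 /A eqxx.
have := @normal_prob_tail R p (Num.sqrt (t - s)) x; rewrite sqrtr_gt0 sqr_sqrtr ?(ltW ts0)//.
exact.
Qed.

End brownian_marginals.

Lemma prode_le_expr (R : realType) n (F : 'I_n -> \bar R) (q : R) :
  (forall i, (0 <= F i <= q%:E)%E) -> (\prod_(i < n) F i <= (q ^+ n)%:E)%E.
Proof.
elim: n F => [|n IHn] F Fq; first by rewrite big_ord0 expr0.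
rewrite big_ord_recr/= exprSr EFinM; have /andP[Fn0 Fnq] := Fq ord_max.
apply: lee_pmul => //; last exact: IHn.
by apply: prode_ge0 => i _; case/andP: (Fq (widen_ord (leqnSn n) i)).
Qed.

Section brownian_small_balls.
Context (R : realType) (d : nat) (dT : measure_display) (T : measurableType dT).
Context (P : probability T R) (W : R -> T -> 'rV[R]_d).
Hypothesis bm : brownian_motion P 0 W.

(** Only three of the [d] factors are kept, so that one exponent serves all
dimensions; dimension [2] would not give a summable bound in [bm_ball_avoidable]. *)
Lemma bm_near_le (t a : R) (C : 'rV[R]_d) : (3 <= d)%N -> 0 < t -> 0 <= a ->
  (P [set w | (`|W t w - C| <= a)%R] <= ((a / Num.sqrt t) ^+ 3)%:E)%E.
Proof.
move=> d3 t0 a0.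
have q0 : 0 <= a / Num.sqrt t by rewrite divr_ge0// sqrtr_ge0.
have [q1|q1] := leP (a / Num.sqrt t) 1; last first.
  apply: (@le_trans _ _ 1%E).
    by apply: probability_le1; apply: (bm_near_measurable bm) => //; exact: ltW.
  by rewrite lee_fin exprn_ege1// ltW.
pose A (i : 'I_d) : set R := `[C ord0 i - a, C ord0 i + a]%classic.
have -> : [set w | `|W t w - C| <= a] =
    [set w | forall i, A i ((W t w - W 0 w) ord0 i)].
  apply/seteqP; split=> w /=.
    move=> /(row_norm_leP _ a0) H i; have := H i.
    by rewrite (bm_start bm) /A/= subr0 !mxE in_itv/= -ler_distl.
  move=> H; apply/(row_norm_leP _ a0) => i; have := H i.
  by rewrite (bm_start bm) /A/= subr0 !mxE in_itv/= -ler_distl.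
rewrite (bm_gaussian bm (lexx 0) t0) => [|i]; last exact: measurable_itv.
rewrite subr0; apply: (@le_trans _ _ ((a / Num.sqrt t) ^+ d)%:E); last first.
  by rewrite lee_fin; exact: ler_wiXn2l.
apply: prode_le_expr => i; rewrite measure_ge0/=.
by apply: normal_prob_itv_le; rewrite ?sqrtr_gt0.
Qed.

End brownian_small_balls.

(** * Oscillation of Brownian paths *)

(** The thresholds [lam / 4 * (3 / 4) ^ n] sum to [lam], and a point of level
[n.+1] is either a point of level [n] or the successor of one. *)
Lemma dyadic_chaining (R : realType) (V : normedModType R) (X : nat -> nat -> V)
    (lam : R) : 0 <= lam ->
  (forall n k, X n.+1 k.*2 = X n k) ->
  (forall n k, (k < 2 ^ n)%N ->
    `|X n k.+1 - X n k| <= lam / 4 * (3 / 4) ^+ n) ->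
  forall n k, (k <= 2 ^ n)%N -> `|X n k - X 0%N 0%N| <= lam * (1 - (3 / 4) ^+ n.+1).
Proof.
move=> lam0 X2 Xle; elim=> [|n IHn] k.
  rewrite expn0; case: k => [|[|//]] _; first by rewrite subrr normr0 expr1; lra.
  have := Xle 0%N 0%N isT; rewrite expr0 expr1; lra.
rewrite expnS mul2n => k_le.
have p0 : 0 <= (3 / 4 : R) ^+ n.+1 by rewrite exprn_ge0//; lra.
have k2 : (k./2 <= 2 ^ n)%N by rewrite -(doubleK (2 ^ n)%N) half_leq.
have IHk := IHn _ k2; rewrite [(3 / 4) ^+ n.+2]exprS.
rewrite -(odd_double_half k) in k_le *; case: (odd k) k_le => /= k_le.
  rewrite add1n -(subrK (X n k./2) (X n.+1 _)) -addrA.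
  have {k_le} /Xle : (k./2.*2 < 2 ^ n.+1)%N by rewrite expnS mul2n -add1n.
  rewrite X2 => step; apply: le_trans (ler_normD _ _) _.
  apply: le_trans (lerD step IHk) _; nra.
rewrite add0n X2; apply: le_trans IHk _; nra.
Qed.

Section chaining_cost.
Variable R : realType.
Implicit Types h lam : R.

Lemma pow_8_9_le : 2 * (8 / 9) ^+ 12 <= (2^-1 : R).
Proof.
have h4 : (8 / 9 : R) ^+ 4 <= 625 / 1000 by rewrite !exprS expr0; lra.
have h40 : 0 <= (8 / 9 : R) ^+ 4 by rewrite exprn_ge0//; lra.
have : (8 / 9 : R) ^+ 12 <= (625 / 1000) ^+ 3.
  by rewrite (exprM _ 4 3) lerXn2r// nnegrE; lra.
rewrite [_ ^+ 3]exprS expr2; lra.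
Qed.

(** Level [n] has [2 ^ n] increments of variance [h / 2 ^ n], to be compared with
the squared threshold, of order [(9 / 16) ^ n]. The ratio of the two decays like
[(8 / 9) ^ n], and [12] is the first power of it that beats the number of
increments with a factor [1 / 2] to spare ([pow_8_9_le]). *)
Lemma dyadic_step_cost n h lam : 0 < h -> 0 < lam ->
  (2 ^ n)%:R * (h / (2 ^ n)%:R / (lam / 4 * (3 / 4) ^+ n) ^+ 2) ^+ 12 <=
  16 ^+ 12 * (h / lam ^+ 2) ^+ 12 / (2 ^ n)%:R.
Proof.
move=> h0 lam0.
have lamN0 : lam != 0 by rewrite gt_eqF.
have -> : h / (2 ^ n)%:R / (lam / 4 * (3 / 4) ^+ n) ^+ 2 =
    16 * (h / lam ^+ 2) * (8 / 9) ^+ n.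
  have p3 : (3 : R) ^+ n != 0 by rewrite expf_neq0// pnatr_eq0.
  have p2 : (2 : R) ^+ n != 0 by rewrite expf_neq0// pnatr_eq0.
  have e4 : (4 : R) ^+ n = 2 ^+ n ^+ 2 by rewrite -exprM mulnC exprM; congr (_ ^+ n); ring.
  have e8 : (8 : R) ^+ n = 2 ^+ n ^+ 3 by rewrite -exprM mulnC exprM; congr (_ ^+ n); ring.
  have e9 : (9 : R) ^+ n = 3 ^+ n ^+ 2 by rewrite -exprM mulnC exprM; congr (_ ^+ n); ring.
  rewrite natrX !expr_div_n e4 e8 e9; field.
  by rewrite lamN0 p2 p3.
have q0 : 0 <= h / lam ^+ 2 by rewrite divr_ge0 ?exprn_ge0// ltW.
move: (h / lam ^+ 2) q0 => q q0.
rewrite 2!exprMn (_ : (8 / 9) ^+ n ^+ 12 = (8 / 9) ^+ 12 ^+ n :> R); last first.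
  by rewrite -!exprM mulnC.
rewrite mulrCA ler_wpM2l ?mulr_ge0 ?exprn_ge0//.
rewrite natrX -exprMn -exprVn lerXn2r ?nnegrE ?mulr_ge0 ?exprn_ge0//.
exact: pow_8_9_le.
Qed.

End chaining_cost.

Lemma within_continuous_dist (R : realType) (V : normedModType R) (A : set R)
    (f : R -> V) (s e : R) : {within A, continuous f} -> A s -> 0 < e ->
  exists2 dl : R, 0 < dl & forall u, A u -> `|u - s| < dl -> `|f u - f s| < e.
Proof.
move=> /subspace_continuousP cf As e0.
have /cvgr_dist_lt /(_ e e0) := cf s As.
rewrite /prop_near1 /within/= -filter_from_ballE => -[dl dl0 H].
exists dl => // u Au us; rewrite distrC.
by apply: H => //; rewrite /ball/= distrC.
Qed.

Lemma dyadic_dense (R : realType) (t h s e : R) : 0 < h -> t <= s <= t + h -> 0 < e ->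
  exists n k, (k <= 2 ^ n)%N /\ `|t + h * k%:R / (2 ^ n)%:R - s| < e.
Proof.
move=> h0 /andP[ts sth] e0; pose n := Num.bound (h / e); exists n.
have p0 : 0 < (2 ^ n)%:R :> R by rewrite ltr0n expn_gt0.
have hn : h / (2 ^ n)%:R < e.
  rewrite ltr_pdivrMr// mulrC -ltr_pdivrMr//.
  apply: (@lt_trans _ _ n%:R); last by rewrite ltr_nat ltn_expl.
  by rewrite archi_boundP// divr_ge0// ltW.
pose y := (s - t) / h * (2 ^ n)%:R.
have y0 : 0 <= y by rewrite mulr_ge0 ?divr_ge0 ?subr_ge0// ltW.
have y1 : y <= (2 ^ n)%:R by rewrite ler_piMl ?(ltW p0)// ler_pdivrMr// mul1r; lra.
have /andP[ky yk] := truncn_itv y0.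
exists (Num.truncn y); split; first by rewrite -(ler_nat R) (le_trans ky).
have -> : s = t + h * y / (2 ^ n)%:R by rewrite /y; field; rewrite !gt_eqF.
set k := Num.truncn y in ky yk *.
rewrite (_ : _ - _ = - (h / (2 ^ n)%:R * (y - k%:R))); last by ring.
rewrite normrN ger0_norm; last by rewrite mulr_ge0 ?subr_ge0// divr_ge0// ltW.
by apply: le_lt_trans hn; rewrite ler_piMr ?divr_ge0 ?ltW// ltrBlDl natr1.
Qed.

Section bm_oscillation.
Context (R : realType) (d : nat) (dT : measure_display) (T : measurableType dT).
Context (P : probability T R) (x0 : 'rV[R]_d) (W : R -> T -> 'rV[R]_d).
Hypothesis bm : brownian_motion P x0 W.
Implicit Types (s t h lam e : R).

(** From one union over the coordinates, the tail constant, and the factor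
[16 ^ 12] of [dyadic_step_cost]; the [2] turns the sum over [1 / 2 ^ n] into one
over [1 / 2 ^ n.+1]. *)
Definition osc_cst : R := 2 * (d%:R * (tail_cst R 12 * 16 ^+ 12)).

Lemma osc_cst_ge0 : 0 <= osc_cst.
Proof.
apply: mulr_ge0 => //; apply: mulr_ge0 => //; apply: mulr_ge0.
  exact: tail_cst_ge0.
exact: exprn_ge0.
Qed.

(** The exceptional event is that some dyadic increment of [[t, t + h]] exceeds its
threshold. Off it, chaining controls the path at dyadic times, and continuity at
all the others. The constant depends on the dimension only, not on the process. *)
Lemma bm_oscillation t h lam : 0 <= t -> 0 < h -> 0 < lam ->
  exists B : set T, [/\ measurable B,
    (P B <= (osc_cst * (h / lam ^+ 2) ^+ 12)%:E)%E &
    forall w, ~ B w -> forall s, t <= s <= t + h -> `|W s w - W t w| <= lam].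
Proof.
move=> t0 h0 lam0.
pose g n k : R := t + h * k%:R / (2 ^ n)%:R.
have g_ge0 n k : 0 <= g n k by rewrite addr_ge0// divr_ge0// mulr_ge0// ltW.
have gS n k : g n k.+1 - g n k = h / (2 ^ n)%:R by rewrite /g -natr1; ring.
have p0 n : 0 < (2 ^ n)%:R :> R by rewrite ltr0n expn_gt0.
pose a n : R := lam / 4 * (3 / 4) ^+ n.
have a0 n : 0 < a n by rewrite mulr_gt0 ?divr_gt0 ?exprn_gt0 ?divr_gt0.
pose E n k := [set w | a n < `|W (g n k.+1) w - W (g n k) w|].
have mE n k : measurable (E n k).
  by apply: (bm_far_measurable bm) => //; exact: ltW.
pose F n := \bigcup_(k : 'I_(2 ^ n)) E n k.
have mF n : measurable (F n) by apply: measurable_bigcup_ord => k; exact: mE.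
pose b := osc_cst * (h / lam ^+ 2) ^+ 12.
have b0 : 0 <= b.
  apply: mulr_ge0; first exact: osc_cst_ge0.
  by apply: exprn_ge0; rewrite divr_ge0 ?exprn_ge0// ltW.
exists (\bigcup_n F n); split; first exact: bigcupT_measurable.
  apply: probability_bigcup_geometric_le => // n.
  apply: (@le_trans _ _ ((2 ^ n)%:R * (d%:R * (tail_cst R 12 *
      (h / (2 ^ n)%:R / a n ^+ 2) ^+ 12)))%:E).
    apply: probability_bigcup_ord_le => // k; rewrite -(gS n k).
    by apply: (bm_far_le bm) => //; rewrite -subr_gt0 gS divr_gt0.
  rewrite lee_fin (mulrCA _ d%:R) (mulrCA _ (tail_cst R 12)).
  have -> : b / (2 ^ n.+1)%:R = d%:R * (tail_cst R 12 *
      (16 ^+ 12 * (h / lam ^+ 2) ^+ 12 / (2 ^ n)%:R)).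
    rewrite /b /osc_cst expnS natrM invfM; field.
    by rewrite !gt_eqF.
  rewrite ler_wpM2l// ler_wpM2l ?tail_cst_ge0//.
  exact: dyadic_step_cost.
move=> w nB.
have gle n k : (k <= 2 ^ n)%N -> `|W (g n k) w - W t w| <= lam * (1 - (3 / 4) ^+ n.+1).
  move=> kn; have g00 : g 0%N 0%N = t by rewrite /g mulr0 mul0r addr0.
  rewrite -[in X in _ - X]g00.
  apply: (@dyadic_chaining _ _ (fun n k => W (g n k) w)) => //; first exact: ltW.
    move=> m j; congr (W _ w); rewrite /g expnS -mul2n !natrM; field.
    by rewrite gt_eqF.
  move=> m j jm; rewrite leNgt; apply/negP => far; apply: nB.
  by exists m => //; exists (Ordinal jm).
move=> s /andP[ts sth]; rewrite leNgt; apply/negP => far.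
have s0 : 0 <= s := le_trans t0 ts.
have e0 : 0 < `|W s w - W t w| - lam by rewrite subr_gt0.
have [dl dl0 near_s] := within_continuous_dist (bm_continuous bm (w:=w)) s0 e0.
have tsh : t <= s <= t + h by rewrite ts.
have [n [k [kn gs]]] := dyadic_dense h0 tsh dl0.
have := near_s (g n k) (g_ge0 _ _) gs; have := gle n k kn.
have : `|W s w - W t w| <= `|W (g n k) w - W s w| + `|W (g n k) w - W t w|.
  by rewrite (distrC (W (g n k) w)) ler_distD.
have : 0 <= lam * (3 / 4) ^+ n.+1 by rewrite mulr_ge0 ?exprn_ge0 ?ltW ?divr_gt0.
lra.
Qed.

End bm_oscillation.

(** * Brownian motion avoids small distant balls *)

Lemma geometric_scale (R : realType) (y : R) I : 16 ^+ I <= y ->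
  exists2 i, (I <= i)%N & 16 ^+ i <= y < 16 ^+ i.+1.
Proof.
move=> Iy; have y0 : 0 <= y by apply: le_trans Iy; rewrite exprn_ge0.
have ex : exists n, y < 16 ^+ n.
  exists (Num.bound y); apply: (lt_trans (archi_boundP y0)).
  by rewrite -natrX ltr_nat ltn_expl.
case: (ex_minnP ex) => -[|n] yn min_n.
  move: (le_lt_trans Iy yn); rewrite expr0 ltNge exprn_ege1//.
  by rewrite (ler_nat R 1 16).
exists n; last by rewrite yn andbT leNgt; apply/negP => /min_n; rewrite ltnn.
rewrite -ltnS ltnNge; apply/negP => nI.
have : 16 ^+ n.+1 <= (16 : R) ^+ I by rewrite ler_weXn2l// (ler_nat R 1 16).
by move=> /le_trans /(_ Iy) /(lt_le_trans yn); rewrite ltxx.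
Qed.

Lemma exp2_inv_small (R : realType) (M e : R) : 0 <= M -> 0 < e ->
  exists I, M / (2 ^ I)%:R <= e.
Proof.
move=> M0 e0; exists (Num.bound (M / e)).
rewrite ler_pdivrMr ?ltr0n ?expn_gt0// mulrC -ler_pdivrMr//.
apply: (le_trans (ltW (archi_boundP _))); first by rewrite divr_ge0// ltW.
by rewrite ler_nat ltnW// ltn_expl.
Qed.

Section hitting.
Context (R : realType) (d : nat).

(** Let [kap = dl * |C|] and let [K] be the constant of [bm_oscillation]. For
[i >= I] the time block from [kap ^ 2 * 16 ^ i] to [kap ^ 2 * 16 ^ i.+1] is cut
into [15 * 32 ^ i] steps of length [kap ^ 2 / 2 ^ i]. To come within [kap] of [C]
during a step, the motion must be within [2 * kap] of [C] at its start, of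
probability at most [(2 / 4 ^ i) ^ 3 = 8 / 64 ^ i], or move by more than [kap]
during it, of probability at most [K / (2 ^ i) ^ 12]. Summing over the steps of
the block leaves a multiple of [1 / 2 ^ i], hence a small total when [I] is large.
Before time [kap ^ 2 * 16 ^ I] the motion would have to travel [|C| / 2]; this is
unlikely as soon as [dl ^ 2 * 16 ^ I] is small, which is how [dl] is chosen. *)
Lemma bm_ball_avoidable (eps : R) : (3 <= d)%N -> 0 < eps ->
  exists2 dl : R, 0 < dl <= 1 &
  forall (dT : measure_display) (T : measurableType dT) (P : probability T R)
    (W : R -> T -> 'rV[R]_d), brownian_motion P 0 W ->
  forall C : 'rV[R]_d, 0 < `|C| ->
  exists B : set T, [/\ measurable B, (P B <= eps%:E)%E &
    forall w, ~ B w -> forall t, 0 <= t -> dl * `|C| < `|W t w - C|].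
Proof.
move=> d3 eps0.
have := osc_cst_ge0 R d; have osc_le := @bm_oscillation R d.
move: (osc_cst R d) osc_le => K osc_le K0.
pose M : R := 2 * (15 * (8 + K)).
have M0 : 0 <= M by rewrite mulr_ge0// mulr_ge0// addr_ge0.
have e2 : 0 < eps / 2 by rewrite divr_gt0.
have [I MI] := exp2_inv_small M0 e2.
(* [eta] bounds the squared ratio of scales in the first time interval. *)
pose eta := Num.min 1 (eps / 2 / (K + 1)).
have K1 : 0 < K + 1 by rewrite ltr_wpDl.
have eta0 : 0 < eta by rewrite lt_min ltr01 divr_gt0.
have eta1 : eta <= 1 by rewrite ge_min lexx.
have Keta : K * eta <= eps / 2.
  apply: (@le_trans _ _ ((K + 1) * eta)); first by rewrite ler_wpM2r ?(ltW eta0)// lerDl.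
  by rewrite -ler_pdivlMl// mulrC ge_min lexx orbT.
have p4 i : 0 < (4 : R) ^+ i by rewrite exprn_gt0.
pose dl := Num.sqrt eta / (4 * 4 ^+ I).
have dl0 : 0 < dl by rewrite divr_gt0 ?sqrtr_gt0// mulr_gt0.
have dl4 : dl <= 1 / 4.
  rewrite /dl ler_pdivrMr ?mulr_gt0// mulrA divfK// mul1r.
  apply: (@le_trans _ _ 1); first by rewrite -sqrtr1 ler_sqrt// ler01.
  by rewrite exprn_ege1// (ler_nat R 1 4).
have dl_eta : dl ^+ 2 * 16 ^+ I * 4 <= eta.
  rewrite /dl expr_div_n sqr_sqrtr ?(ltW eta0)// exprMn.
  have -> : (16 : R) ^+ I = 4 ^+ I ^+ 2.
    by rewrite -exprM mulnC exprM; congr (_ ^+ I); ring.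
  rewrite (_ : _ * 4 = eta / 4); last by field; rewrite gt_eqF.
  by rewrite ler_pdivrMr// ler_peMr ?(ltW eta0)// (ler_nat R 1 4).
exists dl; first by rewrite dl0; lra.
move=> dT T P W bm C C0; set L := `|C| in C0 *.
pose kap := dl * L; have kap0 : 0 < kap by rewrite mulr_gt0.
have kap2 : 0 < kap ^+ 2 by rewrite exprn_gt0.
have p2 i : 0 < (2 : R) ^+ i by rewrite exprn_gt0.
have p16 i : 0 < (16 : R) ^+ i by rewrite exprn_gt0.
(* [tt i k] is the start of step [k] of block [i], and [hh i] its length. *)
pose tt i k : R := kap ^+ 2 * (16 ^+ i + k%:R / 2 ^+ i).
pose hh i : R := kap ^+ 2 / 2 ^+ i.
have tt_gt0 i k : 0 < tt i k by rewrite mulr_gt0// ltr_pwDl// divr_ge0// ltW.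
have hh0 i : 0 < hh i by rewrite divr_gt0.
have L2 : 0 < L / 2 by rewrite divr_gt0.
have [B0 [mB0 PB0 HB0]] :=
  osc_le _ _ _ _ _ bm _ _ _ (lexx 0) (mulr_gt0 kap2 (p16 I)) L2.
have /choice [Osc HO] : forall ik : nat * nat, exists B : set T, [/\ measurable B,
    (P B <= (K * (hh ik.1 / kap ^+ 2) ^+ 12)%:E)%E &
    forall w, ~ B w -> forall s, tt ik.1 ik.2 <= s <= tt ik.1 ik.2 + hh ik.1 ->
      `|W s w - W (tt ik.1 ik.2) w| <= kap].
  by move=> [i k] /=; exact: (osc_le _ _ _ _ _ bm _ _ _ (ltW (tt_gt0 i k)) (hh0 i) kap0).
pose St i k := [set w | `|W (tt i k) w - C| <= 2 * kap] `|` Osc (i, k).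
have mnear i k : measurable [set w | `|W (tt i k) w - C| <= 2 * kap].
  apply: (bm_near_measurable bm); first exact: ltW.
  by rewrite mulr_ge0// ltW.
have mS i k : measurable (St i k).
  by apply: measurableU => //; have [] := HO (i, k).
have PS i k : (P (St i k) <= ((8 + K) / 64 ^+ i)%:E)%E.
  apply: (le_trans (measureU2 _ _ _)) => //; first by have [] := HO (i, k).
  rewrite [X in (_ <= X%:E)%E]mulrDl EFinD; apply: leeD.
    apply: le_trans (bm_near_le bm _ d3 (tt_gt0 i k) _) _.
      by rewrite mulr_ge0// ltW.
    rewrite lee_fin (_ : 8 / 64 ^+ i = (2 / 4 ^+ i) ^+ 3); last first.
      rewrite expr_div_n -exprM mulnC exprM; congr (_ / _ ^+ _); ring.
    have st : kap * 4 ^+ i <= Num.sqrt (tt i k).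
      rewrite -[X in X <= _]ger0_norm ?(ltW (mulr_gt0 kap0 (p4 i)))//.
      rewrite -sqrtr_sqr ler_sqrt ?(ltW (tt_gt0 _ _))// exprMn.
      rewrite ler_pM2l// -exprM mulnC exprM (_ : 4 ^+ 2 = 16); last by ring.
      by rewrite lerDl divr_ge0// ltW.
    have kap2_ge0 : 0 <= 2 * kap by rewrite mulr_ge0// ltW.
    apply: lerXn2r; rewrite ?nnegrE.
    - by rewrite divr_ge0// sqrtr_ge0.
    - by rewrite divr_ge0// ltW.
    rewrite ler_pdivrMr ?sqrtr_gt0// mulrAC ler_pdivlMr// -mulrA ler_pM2l//.
  have [_ + _] := HO (i, k); move/le_trans; apply.
  rewrite lee_fin ler_wpM2l// /hh/= mulrAC divff ?gt_eqF// mul1r exprVn lef_pV2 ?posrE ?exprn_gt0//.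
  rewrite -exprM mulnC exprM.
  apply: lerXn2r; rewrite ?nnegrE ?exprn_ge0//.
  by rewrite -natrX ler_nat.
pose N i := (15 * 32 ^ i)%N.
pose F n := \bigcup_(k : 'I_(N (I + n)%N)) St (I + n)%N k.
have mF n : measurable (F n) by apply: measurable_bigcup_ord => k; exact: mS.
exists (B0 `|` \bigcup_n F n); split.
- by apply: measurableU => //; exact: bigcupT_measurable.
- apply: (le_trans (measureU2 _ _ _)) => //; first exact: bigcupT_measurable.
  rewrite [X in (_ <= X%:E)%E](splitr eps) EFinD; apply: leeD.
    apply: le_trans PB0 _; rewrite lee_fin; apply: le_trans Keta.
    rewrite ler_wpM2l// (_ : _ / _ = dl ^+ 2 * 16 ^+ I * 4); last first.
      by rewrite /kap; field; rewrite gt_eqF.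
    apply: (le_trans _ dl_eta); apply: ler_iXnr => //.
      by rewrite !mulr_ge0 ?exprn_ge0// ltW.
    exact: le_trans dl_eta eta1.
  apply: probability_bigcup_geometric_le => //; first exact: ltW.
  move=> n; apply: le_trans (probability_bigcup_ord_le _ (PS (I + n)%N)) _ => //.
  rewrite lee_fin (_ : _ * _ = M / (2 ^ I)%:R / (2 ^ n.+1)%:R); last first.
    have -> : (64 : R) ^+ (I + n) = 32 ^+ (I + n) * 2 ^+ (I + n).
      by rewrite -exprMn; congr (_ ^+ _); ring.
    rewrite /N natrM !natrX /M (exprD 2) exprS; field.
    by rewrite !expf_neq0// pnatr_eq0.
  by rewrite ler_pM2r// invr_gt0 ltr0n expn_gt0.
move=> w nB t t0.
have nB0 : ~ B0 w by move=> ?; apply: nB; left.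
have [tI|It] := leP t (kap ^+ 2 * 16 ^+ I).
  have := HB0 w nB0 t; rewrite add0r t0 tI (bm_start bm) subr0 => /(_ isT) WL.
  have : L <= `|W t w| + `|W t w - C|.
    by rewrite distrC /L -{1}(subrK (W t w) C) addrC ler_normD.
  have : dl * L <= 1 / 4 * L by rewrite ler_wpM2r// ltW.
  lra.
have /geometric_scale [i Ii /andP[it ti]] : 16 ^+ I <= t / kap ^+ 2.
  by rewrite ler_pdivlMr// mulrC ltW.
(* The step of block [i] that contains [t] is the integer part of [y]. *)
pose y := (t / kap ^+ 2 - 16 ^+ i) * 2 ^+ i.
have y0 : 0 <= y by rewrite mulr_ge0 ?subr_ge0// ltW.
have /andP[ky yk] := truncn_itv y0; set k := Num.truncn y in ky yk.
have kN : (k < N i)%N.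
  rewrite -(ltr_nat R); apply: le_lt_trans ky _.
  have -> : (N i)%:R = (16 ^+ i.+1 - 16 ^+ i) * 2 ^+ i :> R.
    rewrite /N natrM natrX (_ : 32%:R = 16 * 2 :> R); last by ring.
    by rewrite exprMn exprS; ring.
  by rewrite ltr_pM2r// ltrD2r.
have te : t = kap ^+ 2 * (16 ^+ i + y / 2 ^+ i).
  by rewrite /y; field; rewrite !gt_eqF.
have nS : ~ St i k w.
  move=> Sw; apply: nB; right; exists (i - I)%N => //; rewrite /F subnKC//.
  by exists (Ordinal kN).
have nO : ~ Osc (i, k) w by move=> ?; apply: nS; right.
have far : 2 * kap < `|W (tt i k) w - C|.
  by rewrite ltNge; apply/negP => ?; apply: nS; left.
have [_ _ /(_ w nO t) /= osc] := HO (i, k).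
have {}osc : `|W t w - W (tt i k) w| <= kap.
  apply: osc; rewrite /hh /tt te; apply/andP; split.
    by rewrite ler_pM2l// lerD2l ler_pM2r ?invr_gt0.
  rewrite -mulrDr ler_pM2l// -addrA lerD2l -[X in _ + X]mul1r -mulrDl.
  by rewrite ler_pM2r ?invr_gt0// natr1 ltW.
rewrite -/kap; have := ler_distD (W t w) (W (tt i k) w) C.
by rewrite (distrC (W (tt i k) w) (W t w)); lra.
Qed.

End hitting.

(** * Measurability of the event of never hitting the balls *)

Section euclidean_norm.
Variables (R : realType) (d : nat).
Implicit Types (x y c : 'rV[R]_d) (r : R).

Lemma norm_le_enorm x : `|x| <= enorm x.
Proof.
have s0 : 0 <= enorm x by exact: sqrtr_ge0.
apply/(row_norm_leP _ s0) => i; rewrite -sqrtr_sqr ler_sqrt; last first.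
  by rewrite sumr_ge0// => j _; exact: sqr_ge0.
by rewrite (bigD1 i)//= lerDl sumr_ge0// => j _; exact: sqr_ge0.
Qed.

Lemma enorm_le_norm x : enorm x <= d%:R * `|x|.
Proof.
have d0 : 0 <= d%:R * `|x| by rewrite mulr_ge0.
rewrite -[leRHS]ger0_norm// -sqrtr_sqr ler_sqrt ?sqr_ge0//.
apply: (@le_trans _ _ (\sum_(i < d) `|x| ^+ 2)).
  apply: ler_sum => i _; rewrite -real_normK ?num_real// lerXn2r ?nnegrE//.
  exact: coord_le_norm.
rewrite sumr_const card_ord -[_ *+ _]mulr_natl exprMn ler_wpM2r ?sqr_ge0//.
by rewrite -natrX ler_nat -mulnn; case: (d) => // n; rewrite leq_pmulr.
Qed.

Lemma enorm_continuous : continuous (@enorm R d).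
Proof.
move=> x; apply: (@continuous_comp _ _ _ (fun y => \sum_(i < d) y ord0 i ^+ 2) Num.sqrt).
  apply: continuous_big => [|i _ y]; first exact: add_continuous.
  apply: (@continuous_comp _ _ _ (fun z : 'rV[R]_d => z ord0 i) (fun u : R => u ^+ 2)).
    exact: coord_continuous.
  exact: sqr_continuous.
exact: sqrt_continuous.
Qed.

Lemma enormB_continuous c : continuous (fun x => enorm (c - x)).
Proof.
have cB : continuous (fun x : 'rV[R]_d => c - x).
  move=> x; apply: (@cvgB R _ _ (nbhs x) _ (fun=> c) id).
    exact: cvg_cst.
  exact: cvg_id.
by move=> x; apply: continuous_comp; [exact: cB|exact: enorm_continuous].
Qed.

Lemma open_enorm_lt c r : open [set x | enorm (c - x) < r].
Proof.
apply: (@open_comp _ _ (fun x => enorm (c - x)) [set u : R | u < r]).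
  by move=> x _; exact: enormB_continuous.
exact: open_lt.
Qed.

Lemma closed_cball c r : closed (cball c r).
Proof.
apply: (@closed_comp _ _ (fun x => enorm (c - x)) [set u : R | u <= r]).
  by move=> x _; exact: enormB_continuous.
exact: closed_le.
Qed.

End euclidean_norm.

Section hitting_measurability.
Context (R : realType) (d : nat) (dT : measure_display) (T : measurableType dT).
Context (P : probability T R) (x0 : 'rV[R]_d) (W : R -> T -> 'rV[R]_d).
Hypothesis bm : brownian_motion P x0 W.
Implicit Types (c : nat -> 'rV[R]_d) (r : nat -> R).

Lemma bm_enorm_ge_measurable t (a : 'rV[R]_d) (u : R) : 0 <= t ->
  measurable [set w | u <= enorm (a - W t w)].
Proof.
move=> t0; have /(_ measurableT) mW := bm_measurable bm t0.
have -> : [set w | u <= enorm (a - W t w)] =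
    ~` ([set: T] `&` W t @^-1` [set x | enorm (a - x) < u]).
  by rewrite setTI; apply/seteqP; split=> w /=; rewrite leNgt => /negP.
apply: measurableC; apply: mW; apply: sub_sigma_algebra.
exact: open_enorm_lt.
Qed.

Lemma bm_enormB_continuous (a : 'rV[R]_d) w :
  {within [set t : R | 0 <= t], continuous (fun t => enorm (a - W t w))}.
Proof.
move=> t; apply: (@continuous_comp (subspace [set t : R | 0 <= t]) _ _
  (W^~ w) (fun x => enorm (a - x))).
  exact: (bm_continuous bm).
exact: enormB_continuous.
Qed.

(** On a compact time interval a path that misses a closed ball stays at a positive
distance from it, and by continuity it suffices to test this distance at dyadic
times; this writes the event with countable operations only. *)
Lemma never_hits_measurable c r : measurable (never_hits c r W).
Proof.
(* [g N j k], for [k <= 2 ^ j], runs over the dyadic times of [[0, N + 1]]. *)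
pose g (N j k : nat) : R := 0 + N.+1%:R * k%:R / (2 ^ j)%:R.
have g0 N j k : 0 <= g N j k by rewrite /g add0r divr_ge0// mulr_ge0.
have gN N j k : (k <= 2 ^ j)%N -> g N j k <= N.+1%:R.
  by move=> kj; rewrite /g add0r ler_pdivrMr ?ltr0n ?expn_gt0// ler_wpM2l// ler_nat.
pose A n N m := \bigcap_j \bigcap_(k in [set k | (k <= 2 ^ j)%N])
  [set w | r n + m.+1%:R^-1 <= enorm (c n - W (g N j k) w)].
have -> : never_hits c r W = \bigcap_n \bigcap_N \bigcup_m A n N m.
  apply/seteqP; split=> w.
    move=> nh n _ N _; pose phi t := enorm (c n - W t w).
    have N0 : 0 <= N.+1%:R :> R by [].
    have cphi : {within `[0, N.+1%:R], continuous phi}.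
      apply: (@continuous_subspaceW R R `[0, N.+1%:R]%classic
        [set t : R | 0 <= t] phi); last exact: (@bm_enormB_continuous (c n) w).
      by move=> t /=; rewrite in_itv/= => /andP[].
    have [u u0N umin] := EVT_min N0 cphi.
    have phiu : r n < phi u.
      rewrite ltNge; apply/negP => le_r; apply: (nh u _ n) => //.
      by move: u0N; rewrite in_itv/= => /andP[].
    exists (Num.bound (phi u - r n)^-1) => // j _ k kj.
    rewrite /mkset; apply: (@le_trans _ _ (phi u)); last first.
      by apply: umin; rewrite in_itv/= g0 gN.
    rewrite -lerBrDl invf_ple ?posrE ?subr_gt0//.
    apply: ltW; apply: lt_trans (archi_boundP _) _; last by rewrite ltr_nat.
    by rewrite invr_ge0 subr_ge0 ltW.
  move=> H t t0 n hit; pose N := Num.bound t.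
  have [m _ Am] := H n I N I.
  have e0 : 0 < m.+1%:R^-1 :> R by rewrite invr_gt0.
  have [dl dl0 near_t] :=
    within_continuous_dist (@bm_enormB_continuous (c n) w) t0 e0.
  have tN : 0 <= t <= 0 + N.+1%:R.
    rewrite t0 add0r; apply: ltW; apply: lt_trans (archi_boundP t0) _.
    by rewrite ltr_nat.
  have [|j [k [kj gt]]] := @dyadic_dense _ 0 N.+1%:R t dl _ tN dl0; first by [].
  have far : r n + m.+1%:R^-1 <= enorm (c n - W (g N j k) w) := Am j I k kj.
  have le_r : enorm (c n - W t w) <= r n := hit.
  have /ltr_normlW := near_t (g N j k) (g0 _ _ _) gt.
  by rewrite ltrBlDr ltNge addrC (le_trans _ far)// lerD2r.
apply: bigcapT_measurable => n; apply: bigcapT_measurable => N.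
apply: bigcupT_measurable => m; apply: bigcapT_measurable => j.
apply: bigcap_measurable => [|k _]; first by exists 0%N.
exact: bm_enorm_ge_measurable.
Qed.

End hitting_measurability.

(** * Topology of the complement of balls centred at integer points *)

Section segments.
Variables (R : realType) (d : nat).
Implicit Types a b : 'rV[R]_d.

Definition segment a b : set 'rV[R]_d :=
  [set a + s *: (b - a) | s in [set s : R | 0 <= s <= 1]].

Lemma segment_left a b : segment a b a.
Proof. by exists 0; rewrite /= ?lexx ?ler01// scale0r addr0. Qed.

Lemma segment_right a b : segment a b b.
Proof. by exists 1; rewrite /= ?lexx ?ler01// scale1r addrC subrK. Qed.

Lemma connected_segment a b : connected (segment a b).
Proof.
apply: connected_continuous_connected.
  apply/connected_intervalP => x y /= /andP[x0 _] /andP[_ y1] z /andP[xz zy].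
  by rewrite (le_trans x0)// (le_trans zy).
apply: continuous_subspaceT => s.
apply: (@cvgD R _ _ (nbhs s) _ (fun=> a) (fun s => s *: (b - a))).
  exact: cvg_cst.
by apply: cvgZr_tmp; exact: cvg_id.
Qed.

Lemma segment_coord a b i y : segment a b y -> a ord0 i = b ord0 i ->
  y ord0 i = a ord0 i.
Proof. by move=> [s _ <-] ab; rewrite !mxE ab subrr mulr0 addr0. Qed.

End segments.

Section lattice_balls.
Variables (R : realType) (d : nat).
Implicit Types (z : 'rV[int]_d) (x y : 'rV[R]_d).

Definition lattice_pt z : 'rV[R]_d := \row_i (z ord0 i)%:~R.

Lemma lattice_pt_sep z z' : z != z' -> 1 <= `|lattice_pt z - lattice_pt z'|.
Proof.
move=> zz'; have [i zi] : exists i, z ord0 i != z' ord0 i.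
  apply/existsP; apply: contra_neqT zz'; rewrite negb_exists => /forallP zz'.
  by apply/rowP => i; apply/eqP; rewrite -[_ == _]negbK; exact: zz'.
apply: le_trans (coord_le_norm _ i); rewrite !mxE -rmorphB/=; apply: norm_intr_ge1.
  exact: intr_int.
by rewrite intr_eq0 subr_eq0.
Qed.

(** Points with a half-integer coordinate form the walls of the unit cells centred
at integer points. *)
Lemma half_integer_far z y i (k : int) : y ord0 i = k%:~R + 1 / 2 ->
  1 / 2 <= `|lattice_pt z - y|.
Proof.
move=> yi; apply: le_trans (coord_le_norm _ i); rewrite !mxE yi.
have [zk|kz] := leP (z ord0 i) k.
  have : (z ord0 i)%:~R <= k%:~R :> R by rewrite ler_int.
  by move=> ?; rewrite ler0_norm; lra.
have : k%:~R + 1 <= (z ord0 i)%:~R :> R.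
  by rewrite -[1]/(1%:~R) -intrD ler_int lezD1.
by move=> ?; rewrite ger0_norm; lra.
Qed.

Lemma nearest_lattice_pt x : exists z, `|x - lattice_pt z| <= 1 / 2.
Proof.
exists (\row_i Num.floor (x ord0 i + 1 / 2)).
have h : 0 <= 1 / 2 :> R by lra.
apply/(row_norm_leP _ h) => i; rewrite !mxE.
have /andP[] := floor_itv (x ord0 i + 1 / 2).
rewrite intrD ler_norml; lra.
Qed.

Lemma enormZ_ge (s : R) x : 1 <= s -> enorm x <= enorm (s *: x).
Proof.
move=> s1; rewrite ler_sqrt ?sumr_ge0// => [|i _]; last exact: sqr_ge0.
apply: ler_sum => i _; rewrite !mxE exprMn ler_peMl ?sqr_ge0//.
by rewrite exprn_ege1.
Qed.

Lemma enormN x : enorm (- x) = enorm x.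
Proof. by congr Num.sqrt; apply: eq_bigr => i _; rewrite mxE sqrrN. Qed.

Variables (z : nat -> 'rV[int]_d) (r : nat -> R).
Hypothesis z_inj : injective z.
Hypothesis r_gt0 : forall n, 0 < r n.
Hypothesis r_small : forall n, r n <= 1 / 4.
Let c n := lattice_pt (z n).
Let Omega := ~` (\bigcup_n cball (c n) (r n)).

Lemma cball_norm n x : cball (c n) (r n) x -> `|c n - x| <= 1 / 4.
Proof.
by move=> xn; apply: le_trans (norm_le_enorm _) (le_trans xn (r_small n)).
Qed.

(** Balls with distinct centres are at sup distance at least [1 - 2 / 4]. *)
Lemma cballs_near n m x y : cball (c n) (r n) x -> cball (c m) (r m) y ->
  `|x - y| < 1 / 2 -> n = m.
Proof.
move=> /cball_norm xn /cball_norm ym xy; apply: z_inj; apply/eqP.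
apply: contraT => /lattice_pt_sep; rewrite -/(c n) -/(c m).
have := ler_distD x (c n) (c m); have := ler_distD y x (c m).
rewrite (distrC y) => h1 h2 h3; lra.
Qed.

Lemma lattice_cballs_trivIset : trivIset [set: nat] (fun n => cball (c n) (r n)).
Proof.
move=> n m _ _ [x [xn xm]]; apply: (cballs_near xn xm).
by rewrite subrr normr0; lra.
Qed.

Lemma lattice_complement_open : open Omega.
Proof.
rewrite openE => x Ox; rewrite /interior.
have e0 : 0 < 1 / 4 :> R by lra.
have nx : nbhs x (ball x (1 / 4 : R)) by exact: nbhsx_ballx.
have [[n [y [yn yx]]]|none] := pselect (exists n y, cball (c n) (r n) y /\
    ball x (1 / 4 : R) y).
  have nn : nbhs x (~` cball (c n) (r n)).
    apply: open_nbhs_nbhs; split; first by apply: closed_openC; exact: closed_cball.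
    by move=> xn; apply: Ox; exists n.
  apply: filterS (filterI nx nn) => u [ux un] [m _ um]; apply: un.
  suff -> : n = m by [].
  apply: (cballs_near yn um); move: yx ux; rewrite -ball_normE /ball_/= => yx ux.
  have := ler_distD x y u; rewrite (distrC y x); lra.
apply: filterS nx => u ux [n _ un]; apply: none; by exists n, u.
Qed.

Lemma half_integer_Omega y i (k : int) : y ord0 i = k%:~R + 1 / 2 -> Omega y.
Proof.
by move=> yi [n _ /cball_norm]; have := half_integer_far (z n) yi; rewrite -/(c n); lra.
Qed.

(** Inside its cell a point moves away from the centre along a ray, which does not
meet the ball of that cell, if there is one, and stays far from all others until
it reaches the wall. If the point is the centre, there is no ball and the diagonal
serves as the ray. *)
Lemma escape_cell x : (0 < d)%N -> Omega x -> exists (g : 'rV[R]_d) i (k : int),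
  g ord0 i = k%:~R + 1 / 2 /\ segment x g `<=` Omega.
Proof.
move=> d0 Ox; have [z0 xz0] := nearest_lattice_pt x.
have far n y : z n != z0 -> `|y - lattice_pt z0| <= 1 / 2 -> ~ cball (c n) (r n) y.
  move=> zn yz /cball_norm; have := lattice_pt_sep zn.
  have := ler_distD y (c n) (lattice_pt z0); rewrite -/(c n); lra.
have half_coord (v : 'rV[R]_d) : `|v| = 1 / 2 -> exists i (k : int),
    (lattice_pt z0 + v) ord0 i = k%:~R + 1 / 2.
  move=> v2; have /mx_norm_neq0 [[a i]] : mx_norm v != 0.
    by rewrite -[mx_norm v]/(`|v|) v2; lra.
  rewrite -[mx_norm v]/(`|v|) v2 (ord1 a)/= => vi; exists i.
  have [v0|v0] := leP 0 (v ord0 i).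
    by exists (z0 ord0 i); rewrite !mxE vi ger0_norm.
  exists (z0 ord0 i - 1); rewrite !mxE intrB.
  by move: vi; rewrite ltr0_norm// => vi; lra.
have [x_eq|x_neq] := eqVneq x (lattice_pt z0).
  have v2 : `|const_mx (1 / 2) : 'rV[R]_d| = 1 / 2.
    apply/eqP; rewrite eq_le; apply/andP; split.
      have h : 0 <= 1 / 2 :> R by lra.
      by apply/(row_norm_leP _ h) => i; rewrite mxE ger0_norm.
    apply: le_trans (coord_le_norm _ (Ordinal d0)).
    by rewrite mxE ger0_norm//; lra.
  have [i [k gk]] := half_coord _ v2.
  exists (lattice_pt z0 + const_mx (1 / 2)), i, k; split => // y [s /andP[s0 s1] <-].
  move=> [n _ yn]; apply: (far n _ _ _ yn).
    apply: contraPneq Ox => zn Ox; apply: Ox; exists n => //.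
    rewrite /cball /closed_ball_ /mkset x_eq /c zn subrr.
    apply: le_trans (enorm_le_norm 0) _.
    by rewrite normr0 mulr0 ltW.
  rewrite x_eq addrAC subrr add0r addrAC subrr add0r normrZ v2 ger0_norm//; lra.
pose u := x - lattice_pt z0.
have u0 : 0 < `|u| by rewrite normr_gt0 subr_eq0.
pose s1 := (2 * `|u|)^-1.
have s1_ge1 : 1 <= s1.
  rewrite /s1 invf_ge1 ?mulr_gt0//; move: xz0; rewrite -/u; lra.
have v2 : `|s1 *: u| = 1 / 2.
  rewrite normrZ ger0_norm; last by rewrite (le_trans _ s1_ge1).
  by rewrite /s1; field; rewrite gt_eqF.
have [i [k gk]] := half_coord _ v2.
exists (lattice_pt z0 + s1 *: u), i, k; split => // y [s /= /andP[s0 s_le1] <-].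
pose q := 1 + s * (s1 - 1).
have q1 : 1 <= q by rewrite lerDl mulr_ge0// subr_ge0.
have qs1 : q <= s1.
  have : s * (s1 - 1) <= s1 - 1 by rewrite ler_piMl// subr_ge0.
  by rewrite /q; lra.
have -> : x + s *: (lattice_pt z0 + s1 *: u - x) = lattice_pt z0 + q *: u.
  by apply/rowP => l; rewrite /q /u !mxE; ring.
move=> [n _ yn]; have [zn|zn] := eqVneq (z n) z0.
  apply: Ox; exists n => //; rewrite /cball /closed_ball_ /mkset.
  apply: le_trans yn; rewrite /c zn opprD addrA subrr add0r -opprB -/u !enormN.
  exact: enormZ_ge.
apply: (far n _ zn _ yn); rewrite addrAC subrr add0r normrZ ger0_norm; last lra.
by rewrite -v2 normrZ [in leRHS]ger0_norm ?ler_wpM2r//; lra.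
Qed.

(** Every point is joined to [p0 = (1/2, ..., 1/2)] by three segments: a ray to a
wall; a segment within that wall, which makes a second coordinate equal to [1/2];
and a segment within this other wall. This is where [d >= 2] is used. *)
Lemma lattice_complement_connected : (1 < d)%N -> connected Omega.
Proof.
move=> d1; have d0 : (0 < d)%N by exact: ltnW.
pose p0 : 'rV[R]_d := const_mx (1 / 2).
have h0 : 1 / 2 = 0%:~R + 1 / 2 :> R by rewrite add0r.
have [A HA] : exists A : 'rV[R]_d -> set 'rV[R]_d, forall x, Omega x ->
    [/\ connected (A x), A x x, A x p0 & A x `<=` Omega].
  suff H x : exists A, Omega x ->
      [/\ connected A, A x, A p0 & A `<=` Omega].
    by have [A HA] := choice H; exists A.
  have [Ox|] := pselect (Omega x); last by exists set0.
  have [g [i [k [gk xg]]]] := escape_cell d0 Ox.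
  have [j ji] : exists j : 'I_d, j != i.
    pose i0 := Ordinal d0; pose i1 := Ordinal d1.
    by have [->|] := eqVneq i i0; [exists i1|exists i0; rewrite eq_sym].
  pose g' : 'rV[R]_d := \row_l (if l == j then 1 / 2 else g ord0 l).
  exists (segment x g `|` segment g g' `|` segment g' p0) => _; split.
  - apply: connectedU; last exact: connected_segment.
      by exists g'; split; [right; exact: segment_right|exact: segment_left].
    apply: connectedU; [|exact: connected_segment|exact: connected_segment].
    by exists g; split; [exact: segment_right|exact: segment_left].
  - by left; left; exact: segment_left.
  - by right; exact: segment_right.
  - move=> y [[/xg//|gy]|gy].
      have gi : g ord0 i = g' ord0 i by rewrite mxE eq_sym (negPf ji).
      by apply: (half_integer_Omega (i := i) (k := k)); rewrite (segment_coord gy).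
    have gj : g' ord0 j = p0 ord0 j by rewrite !mxE eqxx.
    apply: (half_integer_Omega (i := j) (k := 0)).
    by rewrite (segment_coord gy)// gj mxE.
have -> : Omega = \bigcup_(x in Omega) A x.
  apply/seteqP; split=> x; first by move=> Ox; exists x => //; case: (HA x Ox).
  by move=> [y Oy]; have [_ _ _] := HA y Oy; apply.
apply: bigcup_connected => [|x Ox]; last by case: (HA x Ox).
by exists p0 => x Ox; case: (HA x Ox).
Qed.

End lattice_balls.

(** * Enumeration, growth and choice of the clusters *)

(** The bijection with [nat] lists each integer point of the clusters once, so
that overlapping clusters need not be excluded. *)
Lemma infinite_enumeration (T : countType) (D : set T) : infinite_set D ->
  exists2 e : nat -> T, injective e & range e = D.
Proof.
move=> iD; have /pcard_eqP[g] := eq_card_nat (countableP D) iD.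
have /choice[e He] n : exists x, D x /\ g x = n.
  by have [x Dx gx] := @surj _ _ _ _ g n I; exists x.
exists e => [n m enm|]; first by rewrite -(He n).2 -(He m).2 enm.
apply/seteqP; split=> [_ [n _ <-]|x Dx]; first exact: (He n).1.
exists (g x) => //; apply: (@inj _ _ _ g); rewrite ?inE//; first exact: (He _).1.
exact: (He _).2.
Qed.

Lemma infinite_of_unbounded (T : eqType) (D : set T) (h : T -> nat) :
  (forall k, exists2 x, D x & (k < h x)%N) -> infinite_set D.
Proof.
move=> Dh /finite_seqP[s Ds]; have [x + ] := Dh (\max_(y <- s) h y)%N.
rewrite Ds /= => xs; rewrite ltnNge => /negP; apply.
exact: leq_bigmax_seq.
Qed.

Lemma sum_injective_le (R : realType) (I : finType) (h : I -> nat) (a : nat -> R) :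
  injective h -> (forall n, 0 <= a n) ->
  exists N, \sum_(i : I) a (h i) <= \sum_(0 <= n < N) a n.
Proof.
move=> h_inj a0; pose N := (\max_i h i).+1; exists N.
have hN i : (h i < N)%N by rewrite ltnS leq_bigmax.
pose h' i : 'I_N := Ordinal (hN i).
have h'_inj : {in I &, injective h'} by move=> i j _ _ [/h_inj].
rewrite big_mkord -[leLHS](@big_imset _ _ _ _ _ h' I (fun n => a n))//=.
by rewrite [leRHS](bigID (mem (h' @: I)))/= lerDl sumr_ge0.
Qed.

Lemma unbounded_nondecreasing (R : realType) (f : R -> R) :
  {in `[0, +oo[ &, {homo f : x y / x <= y}} ->
  ~ [bounded f x | x in [set x : R | 0 <= x]] ->
  forall M, exists2 X, 0 <= X & forall x, X <= x -> M <= f x.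
Proof.
move=> f_incr f_unb M; apply: contrapT => nX; apply: f_unb.
have fM x : 0 <= x -> f x < M.
  move=> x0; rewrite ltNge; apply/negP => Mx; apply: nX; exists x => // y xy.
  by rewrite (le_trans Mx)// f_incr// in_itv/= andbT// (le_trans x0).
exists (Num.max `|M| `|f 0|); split; first exact: num_real.
move=> B; rewrite gt_max => /andP[MB fB] x /= x0; rewrite ler_norml.
have f0x : f 0 <= f x by rewrite f_incr// in_itv/= andbT.
have := fM x x0; have := ler_norm M; have := ler_norm (- f 0); rewrite normrN; lra.
Qed.

(** With [A = (1 / 4) ^ (d - 2)] the quadratic bound on [g] keeps the radii below
[1 / 4], even where [f] grows fast. *)
Lemma growth_minorant (R : realType) (f : R -> R) (A : R) : 0 < A ->
  {in `[0, +oo[ &, {homo f : x y / x <= y}} ->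
  ~ [bounded f x | x in [set x : R | 0 <= x]] ->
  exists g : R -> R, [/\ {in `[0, +oo[ &, {homo g : x y / x <= y}},
    forall x, g x <= f x, forall x, g x <= A * x ^+ 2 &
    forall M, exists2 X, 0 <= X & forall x, X <= x -> M <= g x].
Proof.
move=> A0 f_incr f_unb; exists (fun x => Num.min (f x) (A * x ^+ 2)); split.
- move=> x y x0 y0 xy; rewrite le_min !ge_min f_incr//=.
  move: x0; rewrite in_itv/= andbT => x0.
  by rewrite ler_wpM2l ?(ltW A0) ?orbT// lerXn2r// nnegrE (le_trans x0).
- by move=> x; rewrite ge_min lexx.
- by move=> x; rewrite ge_min lexx orbT.
move=> M; have [X X0 fX] := unbounded_nondecreasing f_incr f_unb M.
exists (Num.max X (Num.max 1 (M / A))); first by rewrite le_max X0.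
move=> x; rewrite !ge_max => /and3P[Xx x1 Mx]; rewrite le_min fX//=.
rewrite mulrC -ler_pdivrMr//; apply: (le_trans Mx).
by rewrite expr2 ler_peMl// (le_trans ler01).
Qed.

(** Here [Nm.1] is the distance to the cluster and [Nm.2] the number of points on
each side of it. The last inequality says that [m ^ d] terms, each at least
[g N / (2 * d * N) ^ d], add up to at least [k + 1]. It holds for large [N],
since [m] is at least [dl * N / 2]. *)
Lemma cluster_parameters (R : realType) (d : nat) (g : R -> R) (dl : R) (k : nat) :
  (0 < d)%N -> 0 < dl <= 1 ->
  (forall M, exists2 X, 0 <= X & forall x, X <= x -> M <= g x) ->
  exists Nm : nat * nat, [/\ (k < Nm.1)%N, Nm.2.+1%:R <= dl * Nm.1%:R &
    k.+1%:R * (2 * d%:R * Nm.1%:R) ^+ d <= Nm.2%:R ^+ d * g Nm.1%:R].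
Proof.
move=> d0 /andP[dl0 dl1] g_oo.
have [X X0 gX] := g_oo (k.+1%:R * (4 * d%:R / dl) ^+ d).
pose N := (Num.bound X + Num.bound (4 / dl) + k.+1)%N.
have XN : X <= N%:R.
  by apply: (le_trans (ltW (archi_boundP X0))); rewrite ler_nat /N -addnA leq_addr.
have dlN : 4 <= dl * N%:R.
  rewrite mulrC -ler_pdivrMr//; apply: (le_trans (ltW (archi_boundP _))).
    by rewrite divr_ge0// ltW.
  by rewrite ler_nat /N addnAC leq_addl.
have t0 : 0 <= dl * N%:R by apply: le_trans dlN.
have /andP[] := truncn_itv t0; set t := Num.truncn _ => tle tgt.
have /ltnW t3 : (3 < t)%N by rewrite -ltnS -(ltr_nat R) (le_lt_trans dlN).
exists (N, t.-1); split => /=; first by rewrite /N addnS ltnS leq_addl.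
  by rewrite prednK// (leq_trans _ t3).
have mE : t.-1%:R = t%:R - 1 :> R by rewrite -subn1 natrB// (leq_trans _ t3).
have m_ge : dl * N%:R / 2 <= t.-1%:R.
  by rewrite mE; move: tgt; rewrite -natr1; lra.
have -> : 2 * d%:R * N%:R = 4 * d%:R / dl * (dl * N%:R / 2) :> R.
  by field; rewrite gt_eqF.
rewrite exprMn mulrA mulrC.
have g_ge := gX _ XN.
apply: ler_pM => //.
- by rewrite exprn_ge0// divr_ge0.
- by rewrite mulr_ge0// exprn_ge0// divr_ge0 ?mulr_ge0// ltW.
- by rewrite lerXn2r// nnegrE// divr_ge0.
Qed.

(** * Clusters of balls, and the theorem *)

Lemma powR_invnK (R : realType) (b : R) n : (0 < n)%N -> 0 <= b ->
  (b `^ n%:R^-1) ^+ n = b.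
Proof.
move=> n0 b0; rewrite -powR_mulrn ?powR_ge0// -powRrM mulVf ?powRr1//.
by rewrite pnatr_eq0 -lt0n.
Qed.

Section clusters.
Variables (R : realType) (d : nat) (d_gt0 : (0 < d)%N).
Implicit Types N m : nat.

Definition cluster_origin N : 'rV[R]_d :=
  \row_i (if i == Ordinal d_gt0 then N%:R else 0).

Definition cluster_pt N m (v : {ffun 'I_d -> 'I_m}) : 'rV[int]_d :=
  \row_i ((if i == Ordinal d_gt0 then N%:Z else 0) + (v i)%:Z).

Lemma cluster_pt_inj N m : injective (@cluster_pt N m).
Proof.
move=> v w /rowP vw; apply/ffunP => i; apply: val_inj.
by have := vw i; rewrite !mxE => /addrI [].
Qed.

Lemma cluster_origin_norm N : `|cluster_origin N| = N%:R.
Proof.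
apply/eqP; rewrite eq_le; apply/andP; split.
  apply/(row_norm_leP _ (ler0n _ _)) => i; rewrite mxE.
  by case: ifP => _; rewrite ?normr0// ger0_norm.
apply: le_trans (coord_le_norm _ (Ordinal d_gt0)).
by rewrite mxE eqxx ger0_norm.
Qed.

Lemma cluster_pt_near N m (v : {ffun 'I_d -> 'I_m}) :
  `|lattice_pt R (cluster_pt N v) - cluster_origin N| <= m%:R.
Proof.
apply/(row_norm_leP _ (ler0n _ _)) => i; rewrite !mxE intrD.
have -> : (if i == Ordinal d_gt0 then N%:Z else 0)%:~R =
  if i == Ordinal d_gt0 then N%:R else 0 :> R by case: ifP.
by rewrite addrAC subrr add0r ger0_norm ?ler0n// ler_nat ltnW.
Qed.

Lemma cluster_pt_ge N m (v : {ffun 'I_d -> 'I_m}) :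
  N%:R <= enorm (lattice_pt R (cluster_pt N v)).
Proof.
apply: le_trans (norm_le_enorm _); apply: le_trans (coord_le_norm _ (Ordinal d_gt0)).
rewrite !mxE eqxx -[_%:~R]/((N + v (Ordinal d_gt0))%:R).
by rewrite ger0_norm// ler_nat leq_addr.
Qed.

Lemma cluster_pt_le N m (v : {ffun 'I_d -> 'I_m}) : (m <= N)%N ->
  enorm (lattice_pt R (cluster_pt N v)) <= 2 * d%:R * N%:R.
Proof.
move=> mN; apply: le_trans (enorm_le_norm _) _.
rewrite [2 * _]mulrC -mulrA ler_wpM2l//.
rewrite -[lattice_pt _ _](subrK (cluster_origin N)).
apply: le_trans (ler_normD _ _) _; rewrite cluster_origin_norm mulr_natl mulr2n.
by rewrite lerD2r (le_trans (cluster_pt_near N v))// ler_nat.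
Qed.

End clusters.

Theorem theorem3 (R : realType) (d : nat) (hd : (3 <= d)%N) (f : R -> R)
  (f_incr : {in `[0, +oo[ &, {homo f : x y / x <= y}})
  (f_unbounded : ~ [bounded f x | x in [set x : R | 0 <= x]]) :
  exists (c : nat -> 'rV[R]_d) (r : nat -> R),
    let Omega := ~` (\bigcup_n cball (c n) (r n)) in
    (forall n, 0 < r n) /\
    trivIset [set: nat] (fun n => cball (c n) (r n)) /\
    region Omega /\ Omega 0 /\
    separated_centres c /\
    avoidable c r /\
    (forall n, r n ^+ (d - 2) * enorm (c n) ^+ 2 <= f (enorm (c n))) /\
    (\sum_(0 <= n <oo) ((r n / enorm (c n)) ^+ (d - 2))%:E = +oo)%E.
Proof.
have d0 : (0 < d)%N by exact: leq_trans hd.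
have d1 : (1 < d)%N by exact: leq_trans hd.
have p0 : (0 < d - 2)%N by rewrite subn_gt0.
have [g [g_incr g_le_f g_le_sqr g_oo]] :=
  growth_minorant (exprn_gt0 (d - 2) (divr_gt0 ltr01 (ltr0n R 4))) f_incr f_unbounded.
have eps0 k : 0 < 1 / 2 / (2 ^ k.+1)%:R :> R.
  by rewrite !divr_gt0// ltr0n expn_gt0.
pose escapes (k : nat) (u : R) := forall (dT : measure_display)
    (T : measurableType dT) (P : probability T R) (W : R -> T -> 'rV[R]_d),
  brownian_motion P 0 W -> forall C : 'rV[R]_d, 0 < `|C| ->
  exists B : set T, [/\ measurable B, (P B <= (1 / 2 / (2 ^ k.+1)%:R)%:E)%E &
    forall w, ~ B w -> forall t, 0 <= t -> u * `|C| < `|W t w - C|].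
have /choice[dl Hdl] : forall k, exists u, 0 < u <= 1 /\ escapes k u.
  by move=> k; have [u u01 Hu] := bm_ball_avoidable hd (eps0 k); exists u.
(* The [dl k] only have to make the hitting probabilities summable; the [N k],
   chosen afterwards, make the clusters heavy. *)
have /choice[Nm HNm] k := cluster_parameters k d0 (Hdl k).1 g_oo.
pose N k := (Nm k).1; pose m k := (Nm k).2.
have kN k : (k < N k)%N by case: (HNm k).
have mdl k : (m k).+1%:R <= dl k * (N k)%:R by case: (HNm k).
have mass k : k.+1%:R * (2 * d%:R * (N k)%:R) ^+ d <= (m k)%:R ^+ d * g (N k)%:R.
  by case: (HNm k).
have N_gt0 k : (0 < N k)%N by exact: leq_ltn_trans (kN k).
have N0 k : 0 < (N k)%:R :> R by rewrite ltr0n.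
have mN k : (m k <= N k)%N.
  rewrite ltnW// -(ler_nat R); apply: (le_trans (mdl k)).
  by have [/andP[_ dl1] _] := Hdl k; rewrite ler_piMl.
have big_pos k : 0 < k.+1%:R * (2 * d%:R * (N k)%:R) ^+ d :> R.
  by rewrite mulr_gt0// exprn_gt0// !mulr_gt0// ltr0n.
have gN0 k : 0 < g (N k)%:R.
  rewrite ltNge; apply/negP => g_le0; have := lt_le_trans (big_pos k) (mass k).
  by apply/negP; rewrite -leNgt mulr_ge0_le0// exprn_ge0.
have m0 k : (0 < m k)%N.
  rewrite lt0n; apply/eqP => mk; have := lt_le_trans (big_pos k) (mass k).
  by rewrite mk expr0n gtn_eqF// mul0r ltxx.
(* All the integer points of the clusters; an enumeration of [D] gives the
   centres. *)
pose D := [set z | exists k (v : {ffun 'I_d -> 'I_(m k)}), z = cluster_pt d0 (N k) v].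
have Dinf : infinite_set D.
  apply: (@infinite_of_unbounded 'rV[int]_d D (fun z => `|z ord0 (Ordinal d0)|%N)) => k.
  exists (cluster_pt d0 (N k) [ffun=> Ordinal (m0 k)]).
    by exists k, [ffun=> Ordinal (m0 k)].
  by rewrite mxE eqxx ffunE /= addn0.
have [z z_inj zD] := infinite_enumeration Dinf.
have Dz n : D (z n) by rewrite -zD; exists n.
pose c n := lattice_pt R (z n).
have c_ge1 n : 1 <= enorm (c n).
  have [k [v zn]] := Dz n; rewrite /c zn; apply: le_trans (cluster_pt_ge R d0 (N k) v).
  by rewrite (ler_nat R 1) (leq_ltn_trans _ (kN k)).
have c0 n : 0 < enorm (c n) by exact: lt_le_trans (c_ge1 n).
have gc n : 0 < g (enorm (c n)).
  have [k [v zn]] := Dz n; apply: lt_le_trans (gN0 k) _.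
  rewrite g_incr ?in_itv/= ?andbT ?ler0n ?(ltW (c0 n))//.
  by rewrite /c zn; exact: cluster_pt_ge.
pose r n := (g (enorm (c n)) / enorm (c n) ^+ 2) `^ (d - 2)%:R^-1.
have q0 n : 0 < g (enorm (c n)) / enorm (c n) ^+ 2 by rewrite divr_gt0// exprn_gt0.
have rX n : r n ^+ (d - 2) = g (enorm (c n)) / enorm (c n) ^+ 2.
  by rewrite powR_invnK// ltW.
have r0 n : 0 < r n by exact: powR_gt0.
have r4 n : r n <= 1 / 4.
  rewrite -(ler_pXn2r p0) ?nnegrE ?(ltW (r0 n))//.
  by rewrite rX ler_pdivrMr ?exprn_gt0// g_le_sqr.
exists c, r => Omega; split; first exact: r0.
split; first exact: lattice_cballs_trivIset.
split; first by split;
  [exact: lattice_complement_open | exact: lattice_complement_connected].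
split.
  move=> [n _ cn]; have := le_trans cn (r4 n); have := c_ge1 n.
  by rewrite subr0; lra.
split.
  exists (1 / 2) => [|n k nk]; first by rewrite divr_gt0.
  rewrite mul1r mulfV//; apply: le_trans (norm_le_enorm _).
  by apply: lattice_pt_sep; apply/eqP => /z_inj.
split.
  move=> dT T P W bm.
  have /choice[B HB] k : exists B : set T, [/\ measurable B,
      (P B <= (1 / 2 / (2 ^ k.+1)%:R)%:E)%E & forall w, ~ B w -> forall t, 0 <= t ->
      dl k * (N k)%:R < `|W t w - cluster_origin R d0 (N k)|].
    have := (Hdl k).2 _ _ _ _ bm (cluster_origin R d0 (N k)).
    by rewrite cluster_origin_norm; exact.
  have mB : measurable (\bigcup_k B k) by apply: bigcupT_measurable => k; case: (HB k).
  have PB : (P (\bigcup_k B k) <= (1 / 2)%:E)%E.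
    by apply: probability_bigcup_geometric_le => [|k|k]; [lra|case: (HB k)|case: (HB k)].
  (* The cluster and its balls lie in the cube of half-side [m k + 1]. *)
  have sub : ~` (\bigcup_k B k) `<=` never_hits c r W.
    move=> w nB t t0 n hit; have [k [v zn]] := Dz n.
    have [_ _ /(_ w _ t t0) far] := HB k.
    have {}far := far (fun Bw => nB (ex_intro2 _ _ k I Bw)).
    have := cball_norm r4 hit; have := cluster_pt_near R d0 (N k) v; rewrite -zn -/(c n).
    have := ler_distD (c n) (W t w) (cluster_origin R d0 (N k)).
    have := mdl k; rewrite -natr1 (distrC (W t w) (c n)); lra.
  have mnh := never_hits_measurable bm c r.
  apply: (@lt_le_trans _ _ (P (~` \bigcup_k B k))); last first.
    by apply: le_measure => //; rewrite inE//; exact: measurableC.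
  rewrite probability_setC// sube_gt0; apply: le_lt_trans PB _.
  by rewrite lte_fin; lra.
split.
  move=> n; rewrite rX divfK; first exact: g_le_f.
  by rewrite expf_neq0// gt_eqF.
pose a n := (r n / enorm (c n)) ^+ (d - 2).
have a0 n : 0 <= a n by rewrite exprn_ge0// divr_ge0 ?ltW.
have aE n : a n = g (enorm (c n)) / enorm (c n) ^+ d.
  rewrite /a expr_div_n rX -mulrA -invfM -exprD subnKC//; exact: ltnW.
have sum_ge k : exists M, k%:R <= \sum_(0 <= n < M) a n.
  have /choice[h Hh] : forall v : {ffun 'I_d -> 'I_(m k)}, exists n,
      z n = cluster_pt d0 (N k) v.
    move=> v; have : D (cluster_pt d0 (N k) v) by exists k, v.
    by rewrite -zD => -[n _ <-]; exists n.
  have h_inj : injective h.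
    by move=> v w vw; apply: (@cluster_pt_inj _ d0 (N k)); rewrite -!Hh vw.
  have [M hM] := sum_injective_le h_inj a0; exists M; apply: le_trans hM.
  have term_ge v : g (N k)%:R / (2 * d%:R * (N k)%:R) ^+ d <= a (h v).
    have cge := cluster_pt_ge R d0 (N k) v; have cle := cluster_pt_le R d0 v (mN k).
    rewrite -Hh -/(c _) in cge cle.
    rewrite aE; apply: ler_pM; rewrite ?(ltW (gN0 k))//.
      by rewrite g_incr ?in_itv/= ?andbT ?ler0n ?(ltW (c0 _)).
    rewrite lef_pV2 ?posrE ?exprn_gt0 ?c0 ?mulr_gt0 ?ltr0n ?N_gt0//.
    by rewrite lerXn2r ?nnegrE ?mulr_ge0// ltW.
  apply: le_trans (ler_sum _ (fun v _ => term_ge v)).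
  rewrite sumr_const card_ffun !card_ord -[leRHS]mulr_natl natrX mulrA.
  rewrite ler_pdivlMr ?exprn_gt0 ?mulr_gt0 ?ltr0n ?N_gt0//.
  apply: le_trans (mass k); rewrite ler_wpM2r ?exprn_ge0 ?mulr_ge0//.
  by rewrite ler_nat.
apply/eqyP => A A0; have [M aM] := sum_ge (Num.bound A).
apply: (@le_trans _ _ (\sum_(0 <= n < M) (a n)%:E)%E).
  rewrite sumEFin lee_fin; apply: le_trans aM.
  by rewrite ltW// archi_boundP// ltW.
by apply: nneseries_lim_ge => n _ _; rewrite lee_fin.
Qed.
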